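(* Let $\phi\in(\mathcal{S}^\circ)^{2r}$ be a fixed point of the McKean-Vlasov system $\dot\mu_j^\iota(t)=\mu_j^\iota(t)A^{j,\iota}_{\mu(t)}$, $1\le j\le r$, $\iota\in\{c,p\}$, and let $\Gamma$ be a relatively open subset of $\mathcal{S}^{2r}$ containing $\phi$. If $F$ is positive definite in $\Gamma$ (with respect to $\phi$), then $F$ is a local Lyapunov function associated with $(\Gamma,\phi)$ for the McKean-Vlasov system. In such a case, the fixed point $\phi$ is locally stable.
   Context: $\mathcal{Z}=\{1,\ldots,K\}$ is a finite set; $\mathcal{M}_1(\mathcal{Z})$, the set of probability measures on $\mathcal{Z}$ (row vectors), is identified with the simplex $\mathcal{S}=\{p\in\mathbb{R}^K:p_z\ge0,\ \sum_zp_z=1\}$, and $\mathcal{S}^\circ=\{p\in\mathcal{S}:p_z>0\ \forall z\in\mathcal{Z}\}$. Parameters: $r$ is a positive integer; $\alpha_j,p_j^c,p_j^p\in(0,1)$ for $1\le j\le r$ with $p_j^c+p_j^p=1$ and $\sum_j\alpha_j=1$; $\beta>0$; $W:\mathcal{Z}\times\mathcal{Z}\to\mathbb{R}$ is symmetric. $\mathcal{E}\subset\mathcal{Z}\times\mathcal{Z}\setminus\{(z,z):z\in\mathcal{Z}\}$ is symmetric with $(\mathcal{Z},\mathcal{E})$ irreducible, and $a(z,z')=1$ if $(z,z')\in\mathcal{E}$, $a(z,z')=0$ otherwise. **Rate matrices.** For $q=(q^{1,c},q^{1,p},\ldots,q^{r,c},q^{r,p})\in\mathcal{S}^{2r}$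 let $$\psi^{j,c}(z,z',q)=\beta\sum_{x\in\mathcal{Z}}(W(x,z')-W(x,z))\big(\alpha_jp_j^cq_x^{j,c}+\alpha_jp_j^pq_x^{j,p}\big),$$ $$\psi^{j,p}(z,z',q)=\beta\sum_{x\in\mathcal{Z}}(W(x,z')-W(x,z))\Big(\alpha_jp_j^cq_x^{j,c}+\sum_{l=1}^r\alpha_lp_l^pq_x^{l,p}\Big),$$ and for $\iota\in\{c,p\}$ let $\lambda^{j,\iota}_{z,z'}(q)=e^{-(\psi^{j,\iota}(z,z',q))^+}a(z,z')$ for $z\ne z'$, $\lambda^{j,\iota}_{z,z}(q)=-\sum_{z'\ne z}\lambda^{j,\iota}_{z,z'}(q)$, $A^{j,\iota}_q=(\lambda^{j,\iota}_{z,z'}(q))_{z,z'\in\mathcal{Z}}$. Here $u^+=\max(u,0)$. **The function $F$.** With $C\in\mathbb{R}$ a constant not depending on $q$ and $0\log0=0$, $$\begin{aligned}F(q)=&\sum_{j=1}^r\frac{\beta}{2}\bigg\{(\alpha_jp_j^c)^2\sum_{z,z'\in\mathcal{Z}}W(z,z')q_{z'}^{j,c}q_z^{j,c}+2\alpha_j^2p_j^pp_j^c\sum_{z,z'\in\mathcal{Z}}W(z,z')q_{z'}^{j,p}q_z^{j,c}\\&\qquad+\alpha_jp_j^p\sum_{k=1}^r\alpha_kp_k^p\sum_{z,z'\in\mathcal{Z}}W(z,z')q_{z'}^{k,p}q_z^{j,p}\bigg\}\\&+\sum_{j=1}^r\Big(\alpha_jp_j^c\sum_{z\in\mathcal{Z}}q_z^{j,c}\log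 q_z^{j,c}+\alpha_jp_j^p\sum_{z\in\mathcal{Z}}q_z^{j,p}\log q_z^{j,p}\Big)+C.\end{aligned}$$ **Definitions.** A point $\phi=(\phi_j^c,\phi_j^p)_{1\le j\le r}\in\mathcal{S}^{2r}$ is a *fixed point* if $\phi_j^\iota A^{j,\iota}_\phi=0$ for all $j,\iota$. A fixed point $\phi\in(\mathcal{S}^\circ)^{2r}$ is *locally stable* if there is a relatively open subset $\Gamma'$ of $\mathcal{S}^{2r}$ containing $\phi$ such that whenever $\mu(0)\in\Gamma'$ the solution $\mu(t)$ with initial condition $\mu(0)$ converges to $\phi$ as $t\to\infty$. A function $J:\Gamma\to\mathbb{R}$ is *positive definite* (with respect to $\phi$) if for some $L^*\in\mathbb{R}$ the sets $M_L=\{q\in\bar\Gamma:J(q)\le L\}$ decrease continuously to $\{\phi\}$ as $L\downarrow L^*$. A positive definite, $\mathcal{C}^1$ and uniformly continuous function $J:\Gamma\to\mathbb{R}$ is a *local Lyapunov function associated with $(\Gamma,\phi)$* if, for every $\mu(0)\in\Gamma$, the solution $\mu(t)$ with initial condition $\mu(0)$ satisfies $\frac{d}{dt}J(\mu(t))<0$ for all $0\le t<\tau$ such that $\mu(t)\ne\phi$, where $\tau=\inf\{t\ge0:\mu(t)\in\Gamma^c\}$.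
   Formalization: Added: φ is the only fixed point in Γ (otherwise a constant solution at another fixed point gives dF/dt = 0). Where Γ meets the boundary of S^{2r}, C^1 is claimed only on Γ∩(S°)^{2r}, and dF/dt may be -∞ at boundary points, since x log x has infinite slope at 0. *)

(* Defs.v *)
From HB Require Import structures.
From mathcomp Require Import all_boot all_order all_algebra.
From mathcomp Require Import all_classical all_reals all_analysis.

Set Implicit Arguments.
Unset Strict Implicit.
Unset Printing Implicit Defensive.

Import Order.TTheory GRing.Theory Num.Theory.
Import numFieldNormedType.Exports.

Local Open Scope classical_set_scope.
Local Open Scope ring_scope.

Inductive node_kind := central | peripheral.

Record model (R : realType) (r K : nat) := Model {
  alpha : 'I_r -> R;
  p : 'I_r -> node_kind -> R;
  beta : R;
  W : 'I_K -> 'I_K -> R;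
  E : rel 'I_K
}.

Record admissible (R : realType) (r K : nat) (m : model R r K) : Prop :=
  Admissible {
  r_gt0 : (0 < r)%N;
  alpha_in01 : forall j, 0 < alpha m j < 1;
  p_in01 : forall j i, 0 < p m j i < 1;
  p_sum1 : forall j, p m j central + p m j peripheral = 1;
  alpha_sum1 : \sum_(j < r) alpha m j = 1;
  beta_gt0 : 0 < beta m;
  W_sym : forall z z', W m z z' = W m z' z;
  E_irrefl : forall z, ~~ E m z z;
  E_sym : symmetric (E m);
  E_irreducible : forall z z', connect (E m) z z'
}.

(* Ambient space of S^{2r}: row j of q.1 is q^{j,c}, row j of q.2 is q^{j,p}. *)
Notation state R r K := ('M[R]_(r, K) * 'M[R]_(r, K))%type.

Definition pop (R : realType) (r K : nat) (q : state R r K)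
    (j : 'I_r) (i : node_kind) : 'rV[R]_K :=
  row j (match i with central => q.1 | peripheral => q.2 end).

Definition simplex (R : realType) (K : nat) : set 'rV[R]_K :=
  [set v | (forall z, 0 <= v ord0 z) /\ \sum_(z < K) v ord0 z = 1].

Definition simplex_int (R : realType) (K : nat) : set 'rV[R]_K :=
  [set v | simplex v /\ forall z, 0 < v ord0 z].

Definition simplices (R : realType) (r K : nat) : set (state R r K) :=
  [set q | forall j i, simplex (pop q j i)].

Definition simplices_int (R : realType) (r K : nat) : set (state R r K) :=
  [set q | forall j i, simplex_int (pop q j i)].

Definition relatively_open (R : realType) (r K : nat)
    (G : set (state R r K)) : Prop :=
  exists2 U : set (state R r K), open U & G = U `&` @simplices R r K.

Section dynamics.
Context (R : realType) (r K : nat) (m : model R r K).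
Implicit Types (q phi : state R r K) (mu : R -> state R r K).
Implicit Types (j : 'I_r) (i : node_kind) (z : 'I_K).

Definition psi j i z z' q : R :=
  match i with
  | central =>
      beta m * \sum_(x < K) (W m x z' - W m x z) *
        (alpha m j * p m j central * pop q j central ord0 x
         + alpha m j * p m j peripheral * pop q j peripheral ord0 x)
  | peripheral =>
      beta m * \sum_(x < K) (W m x z' - W m x z) *
        (alpha m j * p m j central * pop q j central ord0 x
         + \sum_(l < r) alpha m l * p m l peripheral
                        * pop q l peripheral ord0 x)
  end.

Definition offdiag_rate j i q z z' : R :=
  expR (- Num.max (psi j i z z' q) 0) * (E m z z')%:R.

Definition rate_matrix j i q : 'M[R]_K :=
  \matrix_(z, z') (if z == z' then - \sum_(x < K | x != z) offdiag_rate j i q z x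
                   else offdiag_rate j i q z z').

Definition fixed_point phi : Prop :=
  simplices phi /\ forall j i, pop phi j i *m rate_matrix j i phi = 0.

(* The derivative at t of a function on [0, +oo[ is two-sided for t > 0 and
   one-sided at t = 0. *)
Definition solution mu : Prop :=
  (forall t, 0 <= t -> simplices (mu t)) /\
  (forall t j i, 0 <= t ->
     (s - t)^-1 *: (pop (mu s) j i - pop (mu t) j i)
       @[s --> within `[0, +oo[ t^']
       --> pop (mu t) j i *m rate_matrix j i (mu t)).

Definition locally_stable phi : Prop :=
  exists G' : set (state R r K),
    [/\ relatively_open G', G' phi &
        forall mu, solution mu -> G' (mu 0) -> mu t @[t --> +oo] --> phi].

Definition sublevel (G : set (state R r K)) (J : state R r K -> R) (L : R) :
    set (state R r K) := [set q | closure G q /\ J q <= L].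

(* Hausdorff distance between A and B at most e, up to strictness. *)
Definition hausdorff_close (e : R) (A B : set (state R r K)) : Prop :=
  (forall a, A a -> exists2 b, B b & `|a - b| < e) /\
  (forall b, B b -> exists2 a, A a & `|a - b| < e).

(* Since sublevel G J is monotone in L, "decrease continuously" means that it
   is Hausdorff-continuous in L to the right of Lstar, with limit [set phi]. *)
Definition positive_definite (G : set (state R r K)) phi
    (J : state R r K -> R) : Prop :=
  exists Lstar : R,
    (forall e, 0 < e -> \forall L \near Lstar^'+,
       hausdorff_close e (sublevel G J L) [set phi]) /\
    (\forall L \near Lstar^'+, forall e, 0 < e -> \forall L' \near L,
       hausdorff_close e (sublevel G J L) (sublevel G J L')).

Definition tangent (v : state R r K) : Prop :=
  forall j i, \sum_(z < K) pop v j i ord0 z = 0.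

(* C^1 on the part of G in the relative interior of S^{2r}: the derivatives
   along the tangent space of S^{2r} exist and are continuous.  Only the values
   of J on G matter, as q + h *: v stays in G for h small. *)
Definition C1_on (G : set (state R r K)) (J : state R r K -> R) : Prop :=
  forall v, tangent v ->
    (forall q, (G `&` @simplices_int R r K) q -> derivable J q v) /\
    {within G `&` @simplices_int R r K, continuous (fun q => 'D_v J q)}.

(* Stated on the closure of G, so that J there is the continuous extension of
   its restriction to G, which is what sublevel G J refers to. *)
Definition unif_continuous_on (G : set (state R r K)) (J : state R r K -> R) :
    Prop :=
  forall e, 0 < e -> exists2 d, 0 < d &
    forall q q', closure G q -> closure G q' -> `|q - q'| < d ->
      `|J q - J q'| < e.

Definition exit_time (G : set (state R r K)) mu : \bar R :=
  ereal_inf [set t%:E | t in [set t : R | 0 <= t /\ ~ G (mu t)]].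

(* d/dt J(mu(t)) = l < 0; the value l = -oo is allowed only where mu(t) has a
   vanishing coordinate, because q log q has slope -oo at 0. *)
Definition decreasing_at (J : state R r K -> R) mu (t : R) : Prop :=
  exists l : \bar R,
    [/\ ((s - t)^-1 * (J (mu s) - J (mu t)))%:E
          @[s --> within `[0, +oo[ t^'] --> l,
        (l < 0)%E &
        simplices_int (mu t) -> l \is a fin_num].

Definition local_lyapunov (G : set (state R r K)) phi
    (J : state R r K -> R) : Prop :=
  [/\ positive_definite G phi J, C1_on G J, unif_continuous_on G J &
      forall mu, solution mu -> G (mu 0) ->
        forall t, 0 <= t -> (t%:E < exit_time G mu)%E -> mu t <> phi ->
          decreasing_at J mu t].

Definition quadW (u v : 'rV[R]_K) : R :=
  \sum_(z < K) \sum_(z' < K) W m z z' * v ord0 z' * u ord0 z.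

(* 0 * ln 0 = 0 as required. *)
Definition entropy (u : 'rV[R]_K) : R :=
  \sum_(z < K) u ord0 z * ln (u ord0 z).

Definition F (C : R) q : R :=
  \sum_(j < r) beta m / 2 *
    ((alpha m j * p m j central) ^+ 2
       * quadW (pop q j central) (pop q j central)
     + 2 * alpha m j ^+ 2 * p m j peripheral * p m j central
       * quadW (pop q j central) (pop q j peripheral)
     + alpha m j * p m j peripheral *
       \sum_(k < r) alpha m k * p m k peripheral
         * quadW (pop q j peripheral) (pop q k peripheral))
  + \sum_(j < r) (alpha m j * p m j central * entropy (pop q j central)
      + alpha m j * p m j peripheral * entropy (pop q j peripheral))
  + C.

End dynamics.

(* Main.v *)
Require Import Defs.
From HB Require Import structures.
From mathcomp Require Import all_boot all_order all_algebra.
From mathcomp Require Import all_classical all_reals all_analysis.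
From mathcomp Require Import ring lra.

(** Put [u_z = q_z exp(potential_z)].  The rates satisfy detailed balance: the
    flow from [z] to [z'] is [c(z, z') u_z] with a symmetric conductance [c].
    Along a solution, dF/dt is therefore a positive combination of the sums
    [- 1/2 sum c(z, z') (u_z' - u_z) (ln u_z' - ln u_z)]; these are nonpositive,
    and they all vanish only if every drift vanishes, i.e. at a fixed point.
    At time 0 a coordinate may be 0; by irreducibility some zero coordinate then
    has positive speed, and the slope of F is [-oo] because of [x ln x].  For
    [t > 0] all coordinates are positive.
    Stability: as F does not increase, a solution starting close to [phi] in a
    low sublevel set is trapped near [phi]; if F stayed above some [L > Lstar],
    dF/dt would by compactness be bounded above by a negative constant, which
    would make F unbounded below along the solution. *)

Set Implicit Arguments.
Unset Strict Implicit.
Unset Printing Implicit Defensive.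

Import Order.TTheory GRing.Theory Num.Theory.
Import numFieldNormedType.Exports.
Local Open Scope classical_set_scope.
Local Open Scope ring_scope.

(** * Difference quotients *)

Lemma cvg_fin_sum {R : realType} {T : Type} (FF : set_system T)
    {FFp : Filter FF} (I : finType) (f : I -> T -> R) (l : I -> R) :
  (forall i, f i x @[x --> FF] --> l i) ->
  \sum_i f i x @[x --> FF] --> \sum_i l i.
Proof. by move=> fl; apply: cvg_big => // x; exact: add_continuous. Qed.

(** Limits of this quotient are taken along any filter that converges to [t] and avoids [t]. The
    same rules then serve solutions, whose times are restricted to [[0, +oo[], and directional
    derivatives, which are two-sided. *)
Definition slope {R : realType} (f : R -> R) (t s : R) : R :=
  (s - t)^-1 * (f s - f t).

Section slopes.
Context {R : realType} (FF : set_system R) {FFp : Filter FF} (t : R).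
Hypothesis FFt : s @[s --> FF] --> t.
Hypothesis FFne : \forall s \near FF, s != t.
Implicit Types (f g : R -> R) (l k : R).

(** For [s != t], [f s = f t + (s - t) * slope f t s], and the factor [s - t] tends to 0. *)
Lemma slope_cvg f l : slope f t s @[s --> FF] --> l -> f s @[s --> FF] --> f t.
Proof.
move=> fl; apply: (@cvg_trans _ ((f t + (s - t) * slope f t s) @[s --> FF])).
  apply: near_eq_cvg; near=> s; rewrite /slope mulVKf ?subrKC//.
  by rewrite subr_eq0; near: s; exact: FFne.
suff: f t + (s - t) * slope f t s @[s --> FF] --> f t + (t - t) * l.
  by rewrite subrr mul0r addr0.
apply: cvgD; first exact: cvg_cst.
by apply: cvgM => //; apply: cvgB => //; exact: cvg_cst.
Unshelve. all: by end_near. Qed.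

Lemma slope_cst c : slope (fun=> c) t s @[s --> FF] --> (0 : R).
Proof.
by rewrite /slope; under eq_fun do rewrite subrr mulr0; exact: cvg_cst.
Qed.

Lemma slopeD f g l k : slope f t s @[s --> FF] --> l ->
  slope g t s @[s --> FF] --> k ->
  slope (fun s => f s + g s) t s @[s --> FF] --> l + k.
Proof.
move=> fl gk; apply: cvg_trans (cvgD fl gk); apply: near_eq_cvg.
by near=> s; rewrite /slope ?fctE/=; ring.
Unshelve. all: by end_near. Qed.

Lemma slopeZ c f l : slope f t s @[s --> FF] --> l ->
  slope (fun s => c * f s) t s @[s --> FF] --> c * l.
Proof.
move=> fl; apply: cvg_trans (cvgM (cvg_cst c) fl); apply: near_eq_cvg.
by near=> s; rewrite /slope ?fctE/=; ring.
Unshelve. all: by end_near. Qed.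

Lemma slopeM f g l k : slope f t s @[s --> FF] --> l ->
  slope g t s @[s --> FF] --> k ->
  slope (fun s => f s * g s) t s @[s --> FF] --> l * g t + f t * k.
Proof.
move=> fl gk.
apply: cvg_trans
  (cvgD (cvgM fl (slope_cvg gk)) (cvgM (cvg_cst (f t)) gk)).
apply: near_eq_cvg.
by near=> s; rewrite /slope ?fctE/=; ring.
Unshelve. all: by end_near. Qed.

Lemma slope_sum (I : finType) (f : I -> R -> R) (l : I -> R) :
  (forall i, slope (f i) t s @[s --> FF] --> l i) ->
  slope (fun s => \sum_i f i s) t s @[s --> FF] --> \sum_i l i.
Proof.
move=> fl; pose h := fun s => \sum_(i : I) slope (f i) t s.
apply: (@cvg_trans _ (h s @[s --> FF])); last first.
  by exact: cvg_fin_sum.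
apply: near_eq_cvg; near=> s.
by rewrite /h /slope /= -mulr_sumr sumrB.
Unshelve. all: by end_near. Qed.

Lemma slope_ln f l : 0 < f t -> slope f t s @[s --> FF] --> l ->
  slope (fun s => ln (f s)) t s @[s --> FF] --> (f t)^-1 * l.
Proof.
move=> ft0 fl; set a := f t.
(* Caratheodory's form of the derivative of [ln] at [a] *)
pose g x := if x == a then a^-1 else (x - a)^-1 * (ln x - ln a).
have gc : g x @[x --> a] --> g a.
  apply/cvgrPdist_lt => e e0.
  have /(@cvgrPdist_lt _ R) :
      h^-1 *: (ln (h + a) - ln a) @[h --> 0^'] --> a^-1.
    have [dl <-] := is_derive1_ln ft0.
    move: dl; rewrite /derivable /derive/= => dl.
    under eq_fun do rewrite -[X in X + a]mulr1.
    exact: dl.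
  move=> /(_ e e0); rewrite /dnbhs /within/= => /nbhs_ballP[d d0 dP].
  apply/nbhs_ballP; exists d => //= x xd; rewrite /g eqxx.
  case: eqP => [_|/eqP xa]; first by rewrite subrr normr0.
  have := dP (x - a); rewrite subrK; apply; last by rewrite subr_eq0.
  by move: xd; rewrite /ball/= sub0r opprB.
have -> : (f t)^-1 = g a by rewrite /g eqxx.
apply: cvg_trans (cvgM (continuous_cvg _ gc (slope_cvg fl)) fl).
apply: near_eq_cvg; near=> s; rewrite /g.
(* [f s] may equal [a] at times [s != t]; both sides are then 0, and no division by [f s - a] takes
   place. *)
rewrite /slope ?fctE/= -/a; case: eqP => [->|/eqP xa].
  by rewrite !subrr; ring.
by rewrite mulrCA [X in _ * X = _]mulrAC mulVf ?mul1r// subr_eq0.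
Unshelve. all: by end_near. Qed.

Lemma slope_xlnx f l : 0 < f t -> slope f t s @[s --> FF] --> l ->
  slope (fun s => f s * ln (f s)) t s @[s --> FF] --> (ln (f t) + 1) * l.
Proof.
move=> ft0 fl; have := slopeM fl (slope_ln ft0 fl).
by rewrite mulVKf ?gt_eqF// mulrDl mul1r mulrC.
Qed.

End slopes.

(** * Detailed balance and dissipation *)

Section dirichlet_form.
Context {R : realFieldType} {I : finType} (c : I -> I -> R).
Hypothesis c_sym : forall x y, c x y = c y x.

(** Summation by parts: exchanging [x] and [y] and using the symmetry of [c] gives a second form of
    the sum, and the two forms are averaged. *)
Lemma sum_laplacian (g u : I -> R) :
  \sum_x g x * \sum_y c x y * (u y - u x) =
  - (2^-1 * \sum_x \sum_y c x y * ((g y - g x) * (u y - u x))).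
Proof.
pose S := \sum_x g x * \sum_y c x y * (u y - u x); rewrite -/S.
have S1 : S = \sum_x \sum_y c x y * (g x * (u y - u x)).
  apply: eq_bigr => x _; rewrite mulr_sumr; apply: eq_bigr => y _; ring.
have S2 : S = \sum_x \sum_y c x y * (g y * (u x - u y)).
  rewrite S1 exchange_big; apply: eq_bigr => x _; apply: eq_bigr => y _.
  by rewrite c_sym.
suff -> : \sum_x \sum_y c x y * ((g y - g x) * (u y - u x)) = - (S + S).
  by field.
rewrite {1}S1 S2 -big_split -sumrN; apply: eq_bigr => x _.
rewrite -big_split -sumrN; apply: eq_bigr => y _ /=; ring.
Qed.

Hypothesis c_ge0 : forall x y, 0 <= c x y.

Lemma sum_laplacian_le0 (g u : I -> R) :
  (forall x y, 0 <= (g y - g x) * (u y - u x)) ->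
  \sum_x g x * \sum_y c x y * (u y - u x) <= 0.
Proof.
move=> gu; rewrite sum_laplacian oppr_le0 mulr_ge0 ?invr_ge0//.
by rewrite sumr_ge0// => x _; rewrite sumr_ge0// => y _; rewrite mulr_ge0.
Qed.

(** After summation by parts all terms are nonnegative, so each of them vanishes: either [c x y = 0]
    or [u x = u y]. *)
Lemma sum_laplacian_eq0 (g u : I -> R) :
  (forall x y, 0 <= (g y - g x) * (u y - u x)) ->
  (forall x y, (g y - g x) * (u y - u x) = 0 -> u x = u y) ->
  \sum_x g x * \sum_y c x y * (u y - u x) = 0 ->
  forall x, \sum_y c x y * (u y - u x) = 0.
Proof.
move=> gu gu0; rewrite sum_laplacian => /eqP.
rewrite oppr_eq0 mulf_eq0 invr_eq0 pnatr_eq0/= psumr_eq0; last first.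
  by move=> x _; rewrite sumr_ge0// => y _; rewrite mulr_ge0.
move=> /allP s0 x; rewrite big1// => y _.
have /(_ _)/implyP := s0 x; rewrite mem_index_enum => /(_ isT)/(_ isT).
rewrite psumr_eq0; last by move=> z _; rewrite mulr_ge0.
move=> /allP/(_ y); rewrite mem_index_enum => /(_ isT)/implyP/(_ isT).
rewrite mulf_eq0 => /orP[/eqP->|/eqP/gu0->]; first by rewrite mul0r.
by rewrite subrr mulr0.
Qed.

End dirichlet_form.

(** * Detailed balance of the rates and sign of the dissipation *)

Section free_energy.
Context {R : realType} {r K : nat} (m : model R r K).
Implicit Types (q phi : state R r K) (d : 'I_r -> node_kind -> 'rV[R]_K).
Implicit Types (j : 'I_r) (i : node_kind) (z : 'I_K).

Definition weight j i : R := alpha m j * p m j i.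

(** The differences of this function of [z] are the [psi] of the rates. Multiplied by [weight j i],
    it is the partial derivative of the quadratic part of F in the coordinate [z] of [pop q j i], by
    the symmetry of [W]. *)
Definition potential j i q z : R :=
  match i with
  | central =>
      beta m * \sum_(x < K) W m x z *
        (weight j central * pop q j central ord0 x
         + weight j peripheral * pop q j peripheral ord0 x)
  | peripheral =>
      beta m * \sum_(x < K) W m x z *
        (weight j central * pop q j central ord0 x
         + \sum_(l < r) weight l peripheral * pop q l peripheral ord0 x)
  end.

Lemma psiE j i z z' q :
  psi m j i z z' q = potential j i q z' - potential j i q z.
Proof.
by case: i => /=; rewrite -mulrBr -sumrB; congr (_ * _); apply: eq_bigr => x _;
  rewrite mulrBl.
Qed.

(** With V the potential, the Gibbs weight exp(-V(z)) times the rate exp(-(V(z') - V(z))^+) is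
    exp(-max(V(z), V(z'))), which is symmetric in z and z'. *)
Definition conductance j i q z z' : R :=
  expR (- Num.max (potential j i q z) (potential j i q z')) * (E m z z')%:R.

(** Density of the population with respect to the Gibbs weights [expR (- potential)]. *)
Definition tilt j i q z : R := pop q j i ord0 z * expR (potential j i q z).

(* Detailed balance of the rates with respect to the Gibbs weights
   [expR (- potential)]. *)
Lemma rate_tilt j i q z z' :
  pop q j i ord0 z * offdiag_rate m j i q z z' =
  conductance j i q z z' * tilt j i q z.
Proof.
rewrite /offdiag_rate /conductance /tilt psiE.
have -> : - Num.max (potential j i q z' - potential j i q z) 0 =
    potential j i q z - Num.max (potential j i q z) (potential j i q z').
  rewrite -[in LHS](subrr (potential j i q z)) -addr_maxl opprD opprK addrC.
  by rewrite maxC.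
by rewrite expRD; ring.
Qed.

Definition drift q j i : 'rV[R]_K := pop q j i *m rate_matrix m j i q.

(** Inflow minus outflow. Both sums run over all states including [z] itself; the two extra terms
    cancel. *)
Lemma driftE q j i z : drift q j i ord0 z =
  \sum_z' conductance j i q z' z * tilt j i q z' -
  \sum_z' conductance j i q z z' * tilt j i q z.
Proof.
rewrite mxE (bigD1 z)//= [X in _ = X - _](bigD1 z)//=.
rewrite [X in _ = _ - X](bigD1 z)//=.
rewrite [rate_matrix m j i q z z]mxE eqxx mulrN mulr_sumr.
rewrite opprD addrACA subrr add0r [LHS]addrC; congr (_ - _).
  apply: eq_bigr => y yz.
  by rewrite [rate_matrix m j i q y z]mxE (negbTE yz) rate_tilt.
by apply: eq_bigr => y yz; rewrite rate_tilt.
Qed.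

(** The factor in front of the drift is the partial derivative of F divided by [weight j i]. *)
Definition dissipation q j i : R :=
  \sum_z (potential j i q z + ln (pop q j i ord0 z) + 1) * drift q j i ord0 z.

Hypothesis hm : admissible m.

Lemma weight_gt0 j i : 0 < weight j i.
Proof.
by rewrite mulr_gt0//;
  [case/andP: (alpha_in01 hm j)|case/andP: (p_in01 hm j i)].
Qed.

Lemma conductanceC j i q z z' : conductance j i q z z' = conductance j i q z' z.
Proof. by rewrite /conductance maxC (E_sym hm). Qed.

Lemma drift_laplacian q j i z : drift q j i ord0 z =
  \sum_z' conductance j i q z z' * (tilt j i q z' - tilt j i q z).
Proof.
rewrite driftE -sumrB; apply: eq_bigr => y _.
by rewrite mulrBr (conductanceC j i q y).
Qed.

Lemma conductance_ge0 j i q z z' : 0 <= conductance j i q z z'.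
Proof. by rewrite mulr_ge0// expR_ge0. Qed.

Lemma conductance_gt0 j i q z z' : E m z z' -> 0 < conductance j i q z z'.
Proof. by move=> zz'; rewrite mulr_gt0// ?expR_gt0// zz'. Qed.

Section dissipation.
Context (q : state R r K) (j : 'I_r) (i : node_kind).
Hypothesis q_gt0 : forall z, 0 < pop q j i ord0 z.

Lemma tilt_gt0 z : 0 < tilt j i q z.
Proof. by rewrite mulr_gt0 ?expR_gt0. Qed.

(** [potential + ln q] is the logarithm of [tilt], so the sum has the form treated by
    [sum_laplacian], with [g] an increasing function of [u]. *)
Lemma dissipationE : dissipation q j i =
  \sum_z (ln (tilt j i q z) + 1) *
    \sum_z' conductance j i q z z' * (tilt j i q z' - tilt j i q z).
Proof.
apply: eq_bigr => z _; rewrite drift_laplacian lnM ?posrE ?expR_gt0// expRK.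
by rewrite [ln _ + _]addrC.
Qed.

Lemma ln_monotone (a b : R) : 0 < a -> 0 < b -> 0 <= (ln b - ln a) * (b - a).
Proof.
move=> a0 b0; have [ab|ba] := leP a b.
  by rewrite mulr_ge0// subr_ge0// ler_ln.
by rewrite mulr_le0// subr_le0 ?ler_ln// ltW.
Qed.

Lemma dissipation_le0 : dissipation q j i <= 0.
Proof.
rewrite dissipationE; apply: sum_laplacian_le0.
- by move=> *; exact: conductanceC.
- by move=> *; exact: conductance_ge0.
- by move=> x y; rewrite opprD addrACA subrr addr0 ln_monotone ?tilt_gt0.
Qed.

Lemma dissipation_eq0 : dissipation q j i = 0 -> drift q j i = 0.
Proof.
move=> dq0; apply/rowP => z; rewrite drift_laplacian mxE.
apply: (@sum_laplacian_eq0 _ _ _ _ _ (fun z => ln (tilt j i q z) + 1)).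
- by move=> *; exact: conductanceC.
- by move=> *; exact: conductance_ge0.
- by move=> x y; rewrite opprD addrACA subrr addr0 ln_monotone ?tilt_gt0.
- move=> x y /eqP; rewrite opprD addrACA subrr addr0 mulf_eq0 !subr_eq0.
  by case/orP => [/eqP/ln_inj->|/eqP->]//; rewrite posrE tilt_gt0.
- by rewrite -dissipationE.
Qed.

End dissipation.

(** Differential of F at a point with positive coordinates. The direction [d] is a family of row
    vectors, so that both [drift m q] and [pop v] can be inserted. *)
Definition dF q d : R := \sum_j
  (weight j central * \sum_z
     (potential j central q z + ln (pop q j central ord0 z) + 1)
       * d j central ord0 z
   + weight j peripheral * \sum_z
     (potential j peripheral q z + ln (pop q j peripheral ord0 z) + 1)
       * d j peripheral ord0 z).

Lemma dF_drift_le0 q : (forall j i z, 0 < pop q j i ord0 z) ->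
  dF q (drift q) <= 0.
Proof.
move=> q0; rewrite -oppr_ge0 -sumrN sumr_ge0// => j _.
by rewrite opprD addr_ge0// oppr_ge0 pmulr_rle0 ?weight_gt0//;
  exact: dissipation_le0.
Qed.

(** The left side is a sum of dissipations with positive weights; if it were 0, each dissipation and
    hence each drift would vanish. *)
Lemma dF_drift_lt0 q : simplices_int q -> ~ fixed_point m q ->
  dF q (drift q) < 0.
Proof.
move=> q_int nfix; have q0 j i z : 0 < pop q j i ord0 z by case: (q_int j i).
rewrite lt_neqAle dF_drift_le0// andbT; apply/eqP => d0; apply: nfix; split.
  by move=> j i; case: (q_int j i).
have wd_ge0 j i : 0 <= - (weight j i * dissipation q j i).
  by rewrite oppr_ge0 pmulr_rle0 ?weight_gt0// dissipation_le0.
move/eqP: d0; rewrite -oppr_eq0 -sumrN psumr_eq0; last first.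
  by move=> j _; rewrite opprD addr_ge0// wd_ge0.
move=> /allP d0 j i; apply: dissipation_eq0 => //.
have := d0 j; rewrite mem_index_enum => /(_ isT)/implyP/(_ isT).
rewrite opprD paddr_eq0 ?wd_ge0// !oppr_eq0.
rewrite !(mulf_eq0 (weight _ _)) !(gt_eqF (weight_gt0 _ _)).
by case: i => /andP[/eqP ? /eqP ?].
Qed.

End free_energy.

(** * The slope of F along a path *)

Section gradient.
Context {R : realType} {r K : nat} (m : model R r K).
Hypothesis hm : admissible m.
Implicit Types (q phi : state R r K) (d : 'I_r -> node_kind -> 'rV[R]_K).
Implicit Types (j : 'I_r) (i : node_kind) (z : 'I_K).

(** The quadratic part of F is kept apart from the entropy part [mixing]: it has finite slopes at
    the boundary too, where the entropy may have slope [-oo]. *)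
Definition interaction q : R :=
  \sum_(j < r) beta m / 2 *
    ((alpha m j * p m j central) ^+ 2
       * quadW m (pop q j central) (pop q j central)
     + 2 * alpha m j ^+ 2 * p m j peripheral * p m j central
       * quadW m (pop q j central) (pop q j peripheral)
     + alpha m j * p m j peripheral *
       \sum_(k < r) alpha m k * p m k peripheral
         * quadW m (pop q j peripheral) (pop q k peripheral)).

Definition mixing q : R :=
  \sum_(j < r) (weight m j central * entropy (pop q j central)
      + weight m j peripheral * entropy (pop q j peripheral)).

Lemma FE C q : F m C q = interaction q + mixing q + C.
Proof. by []. Qed.

Definition dinteraction q d : R := \sum_j
  (weight m j central * \sum_z
     potential m j central q z * d j central ord0 z
   + weight m j peripheral * \sum_z
     potential m j peripheral q z * d j peripheral ord0 z).

Definition dmixing q d : R := \sum_j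
  (weight m j central * \sum_z
     (ln (pop q j central ord0 z) + 1) * d j central ord0 z
   + weight m j peripheral * \sum_z
     (ln (pop q j peripheral ord0 z) + 1) * d j peripheral ord0 z).

Lemma dFE q d : dF m q d = dinteraction q d + dmixing q d.
Proof.
rewrite /dF -big_split; apply: eq_bigr => j _ /=.
rewrite addrACA -!mulrDr -!big_split/=.
by congr (_ * _ + _ * _); apply: eq_bigr => z _; ring.
Qed.

Lemma quadWC (u v : 'rV[R]_K) : quadW m u v = quadW m v u.
Proof.
rewrite /quadW exchange_big; apply: eq_bigr => z _; apply: eq_bigr => z' _.
by rewrite (W_sym hm) mulrAC.
Qed.

Lemma sum_potential_central q j (u : 'rV[R]_K) :
  \sum_z potential m j central q z * u ord0 z =
  beta m * (weight m j central * quadW m u (pop q j central)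
            + weight m j peripheral * quadW m u (pop q j peripheral)).
Proof.
rewrite /quadW !mulr_sumr -big_split mulr_sumr; apply: eq_bigr => z _ /=.
rewrite -mulrA mulr_suml !mulr_sumr -big_split mulr_sumr; apply: eq_bigr => x _.
by rewrite /= (W_sym hm x); ring.
Qed.

Lemma sum_potential_peripheral q j (u : 'rV[R]_K) :
  \sum_z potential m j peripheral q z * u ord0 z =
  beta m * (weight m j central * quadW m u (pop q j central)
            + \sum_l weight m l peripheral * quadW m u (pop q l peripheral)).
Proof.
have -> : \sum_l weight m l peripheral * quadW m u (pop q l peripheral) =
    \sum_z \sum_x W m z x * u ord0 z *
      \sum_l weight m l peripheral * pop q l peripheral ord0 x.
  under eq_bigr do rewrite /quadW mulr_sumr; rewrite exchange_big/=.
  apply: eq_bigr => z _.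
  under eq_bigr do rewrite mulr_sumr; rewrite exchange_big/=.
  by apply: eq_bigr => x _; rewrite mulr_sumr; apply: eq_bigr => l _; ring.
rewrite /quadW mulr_sumr -big_split mulr_sumr; apply: eq_bigr => z _ /=.
rewrite -mulrA mulr_suml !mulr_sumr -big_split mulr_sumr; apply: eq_bigr => x _.
by rewrite /= (W_sym hm x); ring.
Qed.

(** The right side is what the product rule gives term by term. Equality with the gradient form
    rests on the symmetry of [W] and, for the peripheral coupling, on the symmetry of the double sum
    over [j] and [k]. *)
Lemma dinteractionE q d : dinteraction q d =
  \sum_(j < r) beta m / 2 *
    ((alpha m j * p m j central) ^+ 2
       * (quadW m (d j central) (pop q j central)
          + quadW m (pop q j central) (d j central))
     + 2 * alpha m j ^+ 2 * p m j peripheral * p m j central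
       * (quadW m (d j central) (pop q j peripheral)
          + quadW m (pop q j central) (d j peripheral))
     + alpha m j * p m j peripheral *
       \sum_(k < r) alpha m k * p m k peripheral
         * (quadW m (d j peripheral) (pop q k peripheral)
            + quadW m (pop q j peripheral) (d k peripheral))).
Proof.
(* [A] collects the coupling between peripheral populations, [B] all other terms. *)
pose A j k := weight m j peripheral * (weight m k peripheral *
  quadW m (d j peripheral) (pop q k peripheral)).
pose B j := weight m j central ^+ 2 * quadW m (d j central) (pop q j central)
  + weight m j central * weight m j peripheral *
    (quadW m (d j central) (pop q j peripheral)
     + quadW m (d j peripheral) (pop q j central)).
transitivity (beta m * (\sum_j B j + \sum_j \sum_k A j k)).
  rewrite -big_split mulr_sumr; apply: eq_bigr => j _.
  rewrite sum_potential_central sum_potential_peripheral /= /A /B -mulr_sumr.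
  by ring.
(* Symmetrising in [j] and [k] produces the factor 1/2 and lets the direction [d] occupy either slot
   of [quadW]. *)
have -> : \sum_j \sum_k A j k = \sum_j \sum_k (A j k + A k j) / 2.
  transitivity (\sum_j \sum_k A j k / 2 + \sum_j \sum_k A k j / 2).
    rewrite [X in _ = _ + X]exchange_big/= -big_split; apply: eq_bigr => j _ /=.
    by rewrite -big_split; apply: eq_bigr => k _ /=; field.
  rewrite -big_split; apply: eq_bigr => j _ /=.
  by rewrite -big_split; apply: eq_bigr => k _ /=; ring.
rewrite -big_split mulr_sumr; apply: eq_bigr => j _ /=.
have -> : \sum_k (A j k + A k j) / 2 =
    (alpha m j * p m j peripheral *
       \sum_(k < r) alpha m k * p m k peripheral
         * (quadW m (d j peripheral) (pop q k peripheral)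
            + quadW m (pop q j peripheral) (d k peripheral))) / 2.
  rewrite mulr_sumr mulr_suml; apply: eq_bigr => k _.
  by rewrite /A (quadWC (pop q j peripheral)) /weight; ring.
rewrite /B (quadWC (pop q j central)) (quadWC (pop q j central)) /weight.
by field.
Qed.

Section slopes.
Context (FF : set_system R) {FFp : Filter FF} (t : R).
Hypothesis FFt : s @[s --> FF] --> t.
Hypothesis FFne : \forall s \near FF, s != t.

Lemma slope_quadW (u v : R -> 'rV[R]_K) (du dv : 'rV[R]_K) :
  (forall z, slope (fun s => u s ord0 z) t s @[s --> FF] --> du ord0 z) ->
  (forall z, slope (fun s => v s ord0 z) t s @[s --> FF] --> dv ord0 z) ->
  slope (fun s => quadW m (u s) (v s)) t s @[s --> FF] -->
    quadW m du (v t) + quadW m (u t) dv.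
Proof.
move=> udu vdv; rewrite -big_split/=; apply: slope_sum => z.
rewrite -big_split/=; apply: slope_sum => z'.
have := slopeZ (c := W m z z') (slopeM FFt FFne (udu z) (vdv z')).
have -> : (fun s => W m z z' * (u s ord0 z * v s ord0 z')) =
    (fun s => W m z z' * v s ord0 z' * u s ord0 z).
  by apply/funext => s; ring.
suff <- : W m z z' * (du ord0 z * v t ord0 z' + u t ord0 z * dv ord0 z') =
    W m z z' * v t ord0 z' * du ord0 z + W m z z' * dv ord0 z' * u t ord0 z.
  by apply.
by ring.
Qed.

Context (mu : R -> state R r K) (d : 'I_r -> node_kind -> 'rV[R]_K).
Hypothesis mu_slope : forall j i z,
  slope (fun s => pop (mu s) j i ord0 z) t s @[s --> FF] --> d j i ord0 z.

Lemma slope_interaction :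
  slope (fun s => interaction (mu s)) t s @[s --> FF] --> dinteraction (mu t) d.
Proof.
rewrite dinteractionE; apply: slope_sum => j; apply: slopeZ.
apply: slopeD; last first.
  apply: slopeZ; apply: slope_sum => k; apply: slopeZ; exact: slope_quadW.
by apply: slopeD; apply: slopeZ; exact: slope_quadW.
Qed.

Hypothesis mu_gt0 : forall j i z, 0 < pop (mu t) j i ord0 z.

Lemma slope_mixing :
  slope (fun s => mixing (mu s)) t s @[s --> FF] --> dmixing (mu t) d.
Proof.
apply: slope_sum => j; apply: slopeD; apply: slopeZ; apply: slope_sum => z;
  exact: slope_xlnx.
Qed.

Lemma slope_F C :
  slope (fun s => F m C (mu s)) t s @[s --> FF] --> dF m (mu t) d.
Proof.
rewrite dFE -[_ + dmixing _ _]addr0; apply: slopeD; last exact: slope_cst.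
by apply: slopeD; [exact: slope_interaction|exact: slope_mixing].
Qed.

End slopes.

End gradient.

(** * Continuity and compactness *)

(** As [ln] is 0 at nonpositive arguments, the function vanishes on the left half-line; only the
    limit at 0 from the right needs an estimate. *)
Lemma continuous_xlnx {R : realType} : continuous (fun x : R => x * ln x).
Proof.
move=> x; have [x0|x0|->] := ltgtP x 0.
- rewrite /continuous_at ln0 ?ltW// mulr0; apply: cvg_near_cst; near=> y.
  by rewrite ln0 ?mulr0// ltW//; near: y; exact: lt_nbhsl.
- by apply: cvgM; [exact: cvg_id|exact: continuous_ln].
rewrite /continuous_at mul0r; apply/cvgr0Pnorm_lt => e e0.
set k := `|ln (e / 2)| + 1; have k0 : 0 < k by rewrite ltr_wpDl.
exists (Num.min 1 (e / 2 / k)); first by rewrite /= lt_min ltr01 !divr_gt0.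
move=> y /=; rewrite sub0r normrN lt_min => /andP[y1 yk].
have [y0|y0] := leP y 0; first by rewrite ln0// mulr0 normr0.
move: y1 yk; rewrite gtr0_norm// => y1 yk.
rewrite ltr0_norm; last by rewrite pmulr_rlt0// ln_lt0// y0.
have e2 : 0 < e / 2 by rewrite divr_gt0.
(* The inequality ln x < x at x = (e/2)/y gives - y ln y < e/2 - y ln(e/2); the last term is below
   e/2 because y k < e/2. *)
have := ln_sublinear (divr_gt0 e2 y0).
rewrite ln_div ?posrE// -(ltr_pM2l y0) mulrCA divff ?gt_eqF// mulr1 => ye.
have : - (y * ln (e / 2)) < e / 2.
  apply: le_lt_trans (_ : y * k < e / 2); last by rewrite -ltr_pdivlMr.
  rewrite -mulrN ler_pM2l// /k (le_trans (ler_norm _))// normrN lerDl//.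
by lra.
Unshelve. all: by end_near. Qed.

Lemma cvg_mx_coord {R : realType} {T : Type} (FF : set_system T)
    {FFp : Filter FF} (a b : nat) (f : T -> 'M[R]_(a, b)) (l : 'M[R]_(a, b)) :
  (forall i j, f x i j @[x --> FF] --> l i j) -> f @ FF --> l.
Proof.
move=> fl; apply/cvg_ballP => e e0.
have : \forall x \near FF, forall i j, ball (l i j) e (f x i j).
  by apply: filter_forall => i; apply: filter_forall => j; exact: cvg_ball.
by apply: filterS => x h; split.
Qed.

(** The box is the image under the continuous map [vec_mx] of a product of segments. *)
Lemma compact_mx_box {R : realType} (a b : nat) (u v : R) :
  compact [set M : 'M[R]_(a, b) | forall i j, u <= M i j <= v].
Proof.
have -> : [set M : 'M[R]_(a, b) | forall i j, u <= M i j <= v] =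
    vec_mx @` [set w : 'rV[R]_(a * b) | forall k, `[u, v]%classic (w ord0 k)].
  apply/seteqP; split => [M Muv|_ [w wuv <-] i j]; last first.
    by rewrite mxE; have := wuv (mxvec_index i j); rewrite /= in_itv.
  exists (mxvec M); last exact: mxvecK.
  by move=> k; case/mxvec_indexP: k => i j; rewrite mxvecE /= in_itv/= Muv.
apply: continuous_compact.
  apply: continuous_subspaceT => w; apply: (cvg_mx_coord (FF := nbhs w)) => i j.
  rewrite mxE; have -> : (fun x : 'rV[R]_(a * b) => vec_mx x i j) =
      (fun x => x ord0 (mxvec_index i j)).
    by apply/funext => x; rewrite mxE.
  exact: coord_continuous.
apply: (@rV_compact R _ (fun=> `[u, v]%classic)) => k.
exact: segment_compact.
Qed.

(** The Heine-Cantor theorem, from the covering form of compactness. *)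
Lemma compact_unif_continuous {R : realType} {V : normedModType R} (A : set V)
    (f : V -> R) : compact A -> continuous f ->
  forall e, 0 < e -> exists2 d, 0 < d &
    forall x y, A x -> A y -> `|x - y| < d -> `|f x - f y| < e.
Proof.
move=> /compact_near_coveringP cA cf e e0.
have : \forall d \near (0 : R)^'+, A `<=`
    [set x | forall y, `|x - y| < d -> `|f x - f y| < e].
  apply: cA => x Ax.
  have /cvgrPdist_lt/(_ (e / 2)) := cf x.
  rewrite divr_gt0// => /(_ isT)/nbhs_ballP[d /= d0 dP].
  (* If [z] is within [d / 2] of [x] and [y] within [s < d / 2] of [z], both lie within [d] of [x],
     where [f] varies by less than [e / 2]. *)
  exists (ball x (d / 2), [set s | s < d / 2]).
    split; first by apply: nbhsx_ballx; rewrite divr_gt0.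
    by apply: nbhs_right_lt; rewrite divr_gt0.
  move=> [z s]/= [xz sd] y zy.
  rewrite -[X in X < _](_ : `|(f x - f y) - (f x - f z)| = _); last first.
    by congr (`|_|); ring.
  rewrite (le_lt_trans (ler_normB _ _))// (splitr e) ltrD// dP//.
    rewrite -ball_normE /= -(subrKA z) (le_lt_trans (ler_normD _ _))//.
    rewrite (splitr d) ltrD//; first by move: xz; rewrite -ball_normE.
    exact: lt_trans sd.
  by apply: le_ball xz; rewrite ler_pdivrMr// mulr2n mulrDr mulr1 lerDl ltW.
move=> H; have [d [d0 dP]] := filter_ex (filterI (nbhs_right_gt 0) H).
by exists d => // x y Ax _; exact: dP.
Qed.

(** * Topology of the product of simplices *)

Section state_space.
Context {R : realType} {r K : nat}.
Implicit Types (q phi : state R r K).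
Implicit Types (j : 'I_r) (i : node_kind) (z : 'I_K).

Lemma popE q j i z : pop q j i ord0 z =
  match i with central => q.1 j z | peripheral => q.2 j z end.
Proof. by case: i; rewrite mxE. Qed.

Lemma cvg_pop q j i z :
  pop q' j i ord0 z @[q' --> q] --> pop q j i ord0 z.
Proof.
under eq_fun do rewrite popE; rewrite popE; case: i.
- apply: (@cvg_comp _ _ _ fst (fun M : 'M[R]_(r, K) => M j z) _ (nbhs q.1)).
    exact: cvg_fst.
  exact: coord_continuous.
- apply: (@cvg_comp _ _ _ snd (fun M : 'M[R]_(r, K) => M j z) _ (nbhs q.2)).
    exact: cvg_snd.
  exact: coord_continuous.
Qed.

Lemma cvg_state {T : Type} (FF : set_system T) {FFp : Filter FF}
    (f : T -> state R r K) q :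
  (forall j i z, pop (f x) j i ord0 z @[x --> FF] --> pop q j i ord0 z) ->
  f @ FF --> q.
Proof.
move=> fq; have -> : f = fun x => ((f x).1, (f x).2).
  by apply/funext => x; case: (f x).
case: q fq => q1 q2 fq.
apply: (@cvg_pair _ _ _ FF (nbhs q1) (nbhs q2));
  apply: cvg_mx_coord => j z.
- by have := fq j central z; rewrite popE; under eq_fun do rewrite popE.
- by have := fq j peripheral z; rewrite popE; under eq_fun do rewrite popE.
Qed.

(** [node_kind] carries no finite type structure, so its two values are joined by hand. *)
Lemma near_forall_pop {T : Type} (FF : set_system T) {FFp : Filter FF}
    (P : T -> 'I_r -> node_kind -> 'I_K -> Prop) :
  (forall j i z, \forall x \near FF, P x j i z) ->
  \forall x \near FF, forall j i z, P x j i z.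
Proof.
move=> FP.
have H i : \forall x \near FF, forall j z, P x j i z.
  by apply: filter_forall => j; apply: filter_forall => z.
by apply: filterS2 (H central) (H peripheral) => x c p j [] z.
Qed.

Definition box (u v : R) : set (state R r K) :=
  [set q | forall j i z, u <= pop q j i ord0 z <= v].

Lemma compact_box u v : compact (box u v).
Proof.
have -> : box u v = [set M : 'M[R]_(r, K) | forall j z, u <= M j z <= v] `*`
    [set M : 'M[R]_(r, K) | forall j z, u <= M j z <= v].
  apply/seteqP; split => [q qb|q [q1 q2] j i z].
    split => j z; first by have := qb j central z; rewrite popE.
    by have := qb j peripheral z; rewrite popE.
  by rewrite popE; case: i; [exact: q1|exact: q2].
by apply: compact_setX; exact: compact_mx_box.
Qed.

Lemma closed_box u v : closed (box u v).
Proof.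
by apply: compact_closed; [exact: norm_hausdorff|exact: compact_box].
Qed.

Lemma simplex_le1 (w : 'rV[R]_K) z : simplex w -> w ord0 z <= 1.
Proof.
move=> [w0 <-]; rewrite (bigD1 z)//= lerDl sumr_ge0// => *; exact: w0.
Qed.

Lemma simplices_box : @simplices R r K `<=` box 0 1.
Proof.
by move=> q qS j i z; have [q0 _] := qS j i; rewrite q0 simplex_le1.
Qed.

Lemma closed_simplices : closed (@simplices R r K).
Proof.
move=> q clq.
have qb : box 0 1 q.
  by apply: closed_box; apply: closure_subset clq; exact: simplices_box.
move=> j i; split => [z|]; first by have /andP[] := qb j i z.
pose f q' := \sum_z pop q' j i ord0 z.
have cf : continuous f by move=> q'; apply: cvg_fin_sum => z; exact: cvg_pop.
have : closed (f @^-1` [set x | x = 1]).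
  by apply: closed_comp => [? _|]; [exact: cf|exact: closed_eq].
apply; apply: closure_subset clq => q' q'S /=; by case: (q'S j i).
Qed.

End state_space.

(** * Continuity of F, of the drift and of the differential *)

Section continuity.
Context {R : realType} {r K : nat} (m : model R r K).
Implicit Types (q phi : state R r K).
Implicit Types (j : 'I_r) (i : node_kind) (z : 'I_K).

Lemma continuous_F C : continuous (F m C).
Proof.
have cW j i j' i' :
    continuous (fun q => quadW m (pop q j i) (pop q j' i')).
  move=> q; apply: cvg_fin_sum => z; apply: cvg_fin_sum => z'.
  by apply: cvgM; [apply: cvgM; [exact: cvg_cst|]|]; exact: cvg_pop.
have cE j i : continuous (fun q => entropy (pop q j i)).
  move=> q; apply: cvg_fin_sum => z.
  apply: (@cvg_comp _ _ _ (fun q => pop q j i ord0 z) (fun x => x * ln x) _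
    (nbhs (pop q j i ord0 z))); first exact: cvg_pop.
  exact: continuous_xlnx.
move=> q; apply: cvgD; last exact: cvg_cst.
apply: cvgD; apply: cvg_fin_sum => j; last first.
  by apply: cvgD; (apply: cvgM; [exact: cvg_cst|exact: cE]).
apply: cvgM; [exact: cvg_cst|apply: cvgD; [apply: cvgD|]];
  (apply: cvgM; [exact: cvg_cst|]).
- exact: cW.
- exact: cW.
- by apply: cvg_fin_sum => k; apply: cvgM; [exact: cvg_cst|exact: cW].
Qed.

Lemma continuous_potential j i z : continuous (potential m j i ^~ z).
Proof.
case: i => q /=; (apply: cvgM; [exact: cvg_cst|apply: cvg_fin_sum => x]);
  (apply: cvgM; [exact: cvg_cst|apply: cvgD]).
- by apply: cvgM; [exact: cvg_cst|exact: cvg_pop].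
- by apply: cvgM; [exact: cvg_cst|exact: cvg_pop].
- by apply: cvgM; [exact: cvg_cst|exact: cvg_pop].
- by apply: cvg_fin_sum => l; apply: cvgM; [exact: cvg_cst|exact: cvg_pop].
Qed.

Lemma continuous_drift j i z : continuous (fun q => drift m q j i ord0 z).
Proof.
have cc z1 z2 : continuous (fun q => conductance m j i q z1 z2).
  move=> q; apply: cvgM; last exact: cvg_cst.
  pose f q' := - Num.max (potential m j i q' z1) (potential m j i q' z2).
  suff cf : continuous f.
    by apply: (@cvg_comp _ _ _ f (@expR R) _ (nbhs (f q)));
      [exact: cf|exact: continuous_expR].
  (* The maximum is written with an absolute value, whose continuity is that of the norm. *)
  have -> : f = fun q' => - ((potential m j i q' z1 + potential m j i q' z2 +
      `|potential m j i q' z1 - potential m j i q' z2|) / 2).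
    by apply/funext => q'; rewrite /f maxr_absE.
  move=> q'; apply: cvgN; apply: cvgM; last exact: cvg_cst.
  apply: cvgD; first by apply: cvgD; exact: continuous_potential.
  by apply: cvg_norm; apply: cvgB; exact: continuous_potential.
have ct z1 : continuous (fun q => tilt m j i q z1).
  move=> q; apply: cvgM; first exact: cvg_pop.
  apply: (@cvg_comp _ _ _ (potential m j i ^~ z1) (@expR R) _
    (nbhs (potential m j i q z1))); last exact: continuous_expR.
  exact: continuous_potential.
move=> q; rewrite /continuous_at driftE; under eq_fun do rewrite driftE.
apply: cvgB; apply: cvg_fin_sum => z'; apply: cvgM; by [exact: cc|exact: ct].
Qed.

Lemma continuous_dF (d : state R r K -> 'I_r -> node_kind -> 'rV[R]_K) q :
  (forall j i z, 0 < pop q j i ord0 z) ->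
  (forall j i z, d q' j i ord0 z @[q' --> q] --> d q j i ord0 z) ->
  dF m q' (d q') @[q' --> q] --> dF m q (d q).
Proof.
move=> q0 dq; apply: cvg_fin_sum => j.
apply: cvgD; (apply: cvgM; [exact: cvg_cst|apply: cvg_fin_sum => z]);
  (apply: cvgM; [|exact: dq]; apply: cvgD; [|exact: cvg_cst]);
  (apply: cvgD; [exact: continuous_potential|]).
- apply: (@cvg_comp _ _ _ (fun q => pop q j central ord0 z) (@ln R) _
    (nbhs (pop q j central ord0 z))); by [exact: cvg_pop|exact: continuous_ln].
- apply: (@cvg_comp _ _ _ (fun q => pop q j peripheral ord0 z) (@ln R) _
    (nbhs (pop q j peripheral ord0 z)));
    by [exact: cvg_pop|exact: continuous_ln].
Qed.

End continuity.

(** * Solutions *)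

Section divergence.
Context {R : realType} {T : Type} (FF : set_system T) {FFp : Filter FF}.
Implicit Types (f g : T -> R) (l c : R).

(** An upper bound is all that the other terms of a sum need when one term tends to [-oo]; at an
    empty coordinate the quotient of x ln x is only known to be bounded above. *)
Definition eventually_ub f := exists B, \forall x \near FF, f x <= B.

Lemma cvg_eventually_ub f l : f @ FF --> l -> eventually_ub f.
Proof.
move=> fl; exists (l + 1).
by apply: (cvgr_le _ fl); rewrite ltrDl.
Qed.

Lemma eventually_ub_sum (I : finType) (P : pred I) (f : I -> T -> R) :
  (forall i, eventually_ub (f i)) ->
  eventually_ub (fun x => \sum_(i | P i) f i x).
Proof.
move=> fub; have /choice[B fB] := fub; exists (\sum_(i | P i) B i).
have : \forall x \near FF, forall i, f i x <= B i by exact: filter_forall.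
by apply: filterS => x h; exact: ler_sum.
Qed.

Lemma eventually_ubD f g : eventually_ub f -> eventually_ub g ->
  eventually_ub (fun x => f x + g x).
Proof.
move=> [A fA] [B gB]; exists (A + B).
by apply: filterS2 fA gB => x; exact: lerD.
Qed.

Lemma eventually_ubM c f : 0 < c -> eventually_ub f ->
  eventually_ub (fun x => c * f x).
Proof.
by move=> c0 [A fA]; exists (c * A); apply: filterS fA => x; rewrite ler_pM2l.
Qed.

Lemma cvgNyD f g : f @ FF --> -oo -> eventually_ub g ->
  f x + g x @[x --> FF] --> -oo.
Proof.
move=> /cvgrNyPle fNy [B gB]; apply/cvgrNyPle => A.
apply: filterS2 (fNy (A - B)) gB => x fx gx.
by rewrite -(subrK B A) lerD.
Qed.

Lemma cvgNyM c f : 0 < c -> f @ FF --> -oo -> c * f x @[x --> FF] --> -oo.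
Proof.
move=> c0 /cvgrNyPle fNy; apply/cvgrNyPle => A.
by apply: filterS (fNy (A / c)) => x; rewrite ler_pdivlMr// mulrC.
Qed.

Lemma cvgNy_sum (I : finType) (f : I -> T -> R) k : f k @ FF --> -oo ->
  (forall i, eventually_ub (f i)) -> \sum_i f i x @[x --> FF] --> -oo.
Proof.
move=> fk fub; under eq_fun do rewrite (bigD1 k)//=.
by apply: (cvgNyD (f := f k)) => //; exact: eventually_ub_sum.
Qed.

End divergence.

Section path_derivative.
Context {R : realType}.

Lemma cvg_within_dnbhs {T : topologicalType} (A : set R) (f : R -> T) (t : R) :
  f @ within A t^' --> f t -> f @ within A (nbhs t) --> f t.
Proof.
move=> ft B Bft.
have H : \forall s \near t, s != t -> A s -> B (f s) := ft B Bft.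
change (\forall s \near t, A s -> B (f s)).
apply: filterS H => s h As; have [->|st] := eqVneq s t; last exact: h.
exact: nbhs_singleton Bft.
Qed.

Lemma within_ge0_cvg (t : R) : s @[s --> within `[0, +oo[ t^'] --> t.
Proof. by apply: cvg_trans; [exact: cvg_within|exact: nbhs_dnbhs]. Qed.

Lemma within_ge0_neq (t : R) : \forall s \near within `[0, +oo[ t^', s != t.
Proof. exact: (cvg_within _ (nbhs_dnbhs_neq t)). Qed.

Lemma within_ge0_ge0 (t : R) : \forall s \near within `[0, +oo[ t^', 0 <= s.
Proof.
by rewrite near_withinE; apply: nearW => s /=; rewrite in_itv/= andbT.
Qed.

(** For [t > 0], increments smaller than [t] stay in [[0, +oo[], so the restricted limit is
    two-sided. *)
Lemma slope_is_derive (f : R -> R) (t l : R) : 0 < t ->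
  slope f t s @[s --> within `[0, +oo[ t^'] --> l -> is_derive t 1 f l.
Proof.
move=> t0 /cvgrPdist_lt fl.
suff H : h^-1 *: (f (h *: 1 + t) - f t) @[h --> 0^'] --> l.
  by apply: DeriveDef; [apply/cvg_ex; exists l|exact: cvg_lim].
apply/cvgrPdist_lt => e e0.
have := fl e e0; rewrite /within /dnbhs /within/= => /nbhs_ballP[d /= d0 dP].
apply/nbhs_ballP; exists (Num.min d t) => /=; first by rewrite lt_min d0.
move=> h /=; rewrite /ball/= sub0r normrN lt_min => /andP[hd ht] h0.
have := dP (h + t); rewrite /slope addrK/= -[h *: 1]/(h * 1) mulr1; apply.
- by rewrite /ball/= opprD addrCA subrr addr0 normrN.
- by rewrite -subr_eq0 addrK.
- rewrite in_itv/= andbT -lerBlDr sub0r; apply/ltW.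
  by move: ht; rewrite ltr_norml => /andP[].
Qed.

End path_derivative.

(** * Positivity of solutions and behaviour of F along them *)

Section solutions.
Context {R : realType} {r K : nat} (m : model R r K).
Hypothesis hm : admissible m.
Implicit Types (q phi : state R r K) (mu : R -> state R r K) (t : R).
Implicit Types (j : 'I_r) (i : node_kind) (z : 'I_K).

Lemma solution_slope mu t j i z : solution m mu -> 0 <= t ->
  slope (fun s => pop (mu s) j i ord0 z) t s @[s --> within `[0, +oo[ t^'] -->
    drift m (mu t) j i ord0 z.
Proof.
move=> [_ /(_ t j i)] + t0 => /(_ t0) mut.
have -> : slope (fun s => pop (mu s) j i ord0 z) t =
    (fun s => ((s - t)^-1 *: (pop (mu s) j i - pop (mu t) j i)) ord0 z).
  by apply/funext => s; rewrite 2!mxE [(- pop _ _ _) _ _]mxE.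
apply: (@cvg_comp _ _ _
  (fun s => (s - t)^-1 *: (pop (mu s) j i - pop (mu t) j i))
  (fun w : 'rV[R]_K => w ord0 z) _ (nbhs (drift m (mu t) j i))) => //.
exact: coord_continuous.
Qed.

Lemma solution_cvg mu t : solution m mu -> 0 <= t ->
  mu s @[s --> within `[0, +oo[ (nbhs t)] --> mu t.
Proof.
move=> mus t0; apply: cvg_within_dnbhs; apply: cvg_state => j i z.
apply: (slope_cvg (f := fun s => pop (mu s) j i ord0 z) (@within_ge0_cvg _ t)
  (@within_ge0_neq _ t)).
exact: solution_slope.
Qed.

Lemma solution_continuous mu (f : state R r K -> R) a b : solution m mu ->
  continuous f -> 0 <= a -> {within `[a, b], continuous (f \o mu)}.
Proof.
move=> mus cf a0; apply/subspace_continuousP => t /=.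
rewrite in_itv/= => /andP[ta _].
apply: (@cvg_comp _ _ _ mu f _ (nbhs (mu t))); last exact: cf.
have t0 : 0 <= t := le_trans a0 ta.
apply: cvg_trans (solution_cvg mus t0); apply: cvg_app.
apply: within_subset => s /=; rewrite !in_itv/= => /andP[/(le_trans a0)->].
by rewrite andbT.
Qed.

(* The inflow into an empty state vanishes only if its neighbours are empty, so
   by irreducibility emptiness would spread to all of [Z]. *)
Lemma positive_of_no_inflow q j i : simplex (pop q j i) ->
  (forall z, pop q j i ord0 z = 0 -> drift m q j i ord0 z <= 0) ->
  forall z, 0 < pop q j i ord0 z.
Proof.
move=> [q0 q1] inflow z; rewrite lt_neqAle q0 andbT eq_sym; apply/eqP => qz.
have step x y : pop q j i ord0 x = 0 -> E m x y -> pop q j i ord0 y = 0.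
  move=> qx xy; have tx : tilt m j i q x = 0 by rewrite /tilt qx mul0r.
  have t_ge0 y' : 0 <= tilt m j i q y' by rewrite mulr_ge0// expR_ge0.
  have := inflow _ qx; rewrite drift_laplacian// tx.
  under eq_bigr do rewrite subr0.
  rewrite (bigD1 y)//= => s0; apply/eqP.
  have : conductance m j i q x y * tilt m j i q y <= 0.
    apply: le_trans s0; rewrite lerDl sumr_ge0// => y' _.
    by rewrite mulr_ge0// conductance_ge0.
  rewrite pmulr_rle0 ?conductance_gt0// pmulr_lle0 ?expR_gt0// => qy.
  by rewrite eq_le qy q0.
have all0 y : pop q j i ord0 y = 0.
  have /connectP[s zs ->] := E_irreducible hm z y.
  elim: s z qz zs => //= x s IH z qz /andP[zx xs]; apply: IH xs.
  exact: step qz zx.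
by move: q1; rewrite big1 => [/esym/eqP|//]; rewrite oner_eq0.
Qed.

(** A zero coordinate with positive drift at [t > 0] would have been negative just before [t]. So no
    empty coordinate has positive drift, and [positive_of_no_inflow] applies. *)
Lemma solution_positive mu t : solution m mu -> 0 < t ->
  simplices_int (mu t).
Proof.
move=> mus t0 j i; have muS := mus.1 t (ltW t0) j i.
split=> //; apply: positive_of_no_inflow => // z muz.
rewrite leNgt; apply/negP => d0.
have : \forall s \near within `[0, +oo[ t^',
    0 < slope (fun s => pop (mu s) j i ord0 z) t s.
  exact: cvgr_gt _ (@solution_slope _ t j i z mus (ltW t0)) _ d0.
rewrite /within /dnbhs /within/= => /nbhs_ballP[d /= dpos dP].
(* This makes [t - e] a nonnegative time within the radius [d] where the slope is positive. *)
pose e := Num.min d t / 2.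
have e0 : 0 < e by rewrite divr_gt0// lt_min dpos.
have ed : e < d by rewrite ltr_pdivrMr// gt_min mulr2n mulrDr mulr1 ltrDl dpos.
have et : e <= t.
  by rewrite ler_pdivrMr// ge_min mulr2n mulrDr mulr1 lerDl (ltW t0) orbT.
have := dP (t - e); rewrite /ball/= opprB addrC subrK gtr0_norm// => /(_ ed).
rewrite lt_eqF ?ltrBlDr ?ltrDl// in_itv/= andbT subr_ge0 et => /(_ isT isT).
rewrite /slope muz subr0 addrAC subrr sub0r invrN mulNr oppr_gt0.
rewrite pmulr_rlt0 ?invr_gt0// ltNge.
have te : 0 <= t - e by rewrite subr_ge0.
by have [+ _] := mus.1 _ te j i => /(_ z) ->.
Qed.

Definition speed q : R := dF m q (drift m q).

(** Mean value theorem. The start [a = 0] is allowed even on the boundary: F is continuous along the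
    solution up to [a], and coordinates are positive at later times. *)
Lemma solution_F_decrease mu C a b c : solution m mu -> 0 <= a -> a <= b ->
  (forall t, a < t -> t < b -> speed (mu t) <= c) ->
  F m C (mu b) - F m C (mu a) <= c * (b - a).
Proof.
move=> mus a0 ab cP.
have [->|aneb] := eqVneq a b; first by rewrite !subrr mulr0.
have {ab} ab : a < b by rewrite lt_neqAle aneb.
have H t : t \in `]a, b[%R -> is_derive t 1 (F m C \o mu) (speed (mu t)).
  rewrite in_itv/= => /andP[ta _]; have t0 := le_lt_trans a0 ta.
  have mut := solution_positive mus t0.
  apply: slope_is_derive => //; apply: slope_F => //.
  - exact: within_ge0_cvg.
  - exact: within_ge0_neq.
  - by move=> j i z; exact: solution_slope mus (ltW t0).
  - by move=> j i z; case: (mut j i).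
have [|t] := MVT ab H.
  exact: (solution_continuous (b := b) mus (@continuous_F _ _ _ m C) a0).
rewrite in_itv/= => /andP[ta tb] ->.
by rewrite ler_pM2r ?subr_gt0// cP.
Qed.

Lemma solution_F_nonincreasing mu C a b : solution m mu -> 0 <= a -> a <= b ->
  F m C (mu b) <= F m C (mu a).
Proof.
move=> mus a0 ab; rewrite -subr_le0 -(mul0r (b - a)).
apply: solution_F_decrease => // t ta _; apply: dF_drift_le0 => // j i z.
by case: (solution_positive mus (le_lt_trans a0 ta) j i).
Qed.

(* At a zero coordinate [x ln x] has slope at most [0] forward in time, and
   slope [-oo] if that coordinate leaves [0] with positive speed. *)
Lemma slope_xlnx_zero_ub mu j i z : solution m mu ->
  pop (mu 0) j i ord0 z = 0 ->
  eventually_ub (within `[0, +oo[ (0 : R)^') (slope (fun s =>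
    pop (mu s) j i ord0 z * ln (pop (mu s) j i ord0 z)) 0).
Proof.
move=> mus mu0; exists 0; apply: filterS (within_ge0_ge0 0) => s s0.
have muS := mus.1 s s0 j i.
rewrite /slope mu0 mul0r !subr0 mulr_ge0_le0 ?invr_ge0//.
by rewrite mulr_ge0_le0 ?(muS.1)// ln_le0// simplex_le1.
Qed.

Lemma slope_xlnx_zero_Ny mu j i z : solution m mu ->
  pop (mu 0) j i ord0 z = 0 -> 0 < drift m (mu 0) j i ord0 z ->
  slope (fun s => pop (mu s) j i ord0 z * ln (pop (mu s) j i ord0 z)) 0 s
    @[s --> within `[0, +oo[ (0 : R)^'] --> -oo.
Proof.
move=> mus mu0; set l := drift _ _ _ _ _ _ => l0.
set x := fun s => pop (mu s) j i ord0 z.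
have xl : slope x 0 s @[s --> within `[0, +oo[ (0 : R)^'] --> l.
  exact: solution_slope.
have x0 : x s @[s --> within `[0, +oo[ (0 : R)^'] --> (0 : R).
  suff : x s @[s --> within `[0, +oo[ (0 : R)^'] --> x 0 by rewrite [x 0]mu0.
  exact: (slope_cvg (@within_ge0_cvg _ 0) (@within_ge0_neq _ 0) xl).
(* Once [ln (x s) <= B], both [ln (x s) <= 0] and [l / 2 * ln (x s) <= A] hold. *)
apply/cvgrNyPle => A; pose B := Num.min 0 (A / (l / 2)).
have l2 : 0 < l / 2 by rewrite divr_gt0.
have xB : \forall s \near within `[0, +oo[ (0 : R)^', x s < expR B.
  exact: cvgr_lt x0 _ (expR_gt0 B).
have xl2 : \forall s \near within `[0, +oo[ (0 : R)^', l / 2 < slope x 0 s.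
  by apply: cvgr_gt xl _ _; rewrite ltr_pdivrMr// mulr2n mulrDr mulr1 ltrDl.
apply: filterS3 xB xl2 (within_ge0_ge0 0) => s sB sl s0.
have {s0} s0 : 0 < s.
  rewrite lt_neqAle s0 andbT; apply/eqP => s_eq0.
  by move: sl; rewrite -s_eq0 /slope (subrr (x 0)) mulr0 ltNge ltW.
have xs0 : 0 < x s.
  have := lt_trans l2 sl.
  by rewrite /slope [x 0]mu0 !subr0 pmulr_rgt0// invr_gt0.
have lnB : ln (x s) <= B by rewrite -(expRK B) ler_ln ?posrE ?expR_gt0// ltW.
move: lnB sl; rewrite /B le_min => /andP[ln0' lnA].
rewrite /slope -/(x s) mu0 mul0r [x 0]mu0 !subr0 mulrA => sl.
(* The quotient is the slope of [x] times a nonpositive logarithm, so replacing the slope by its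
   lower bound [l / 2] can only increase it. *)
rewrite (le_trans (_ : _ <= l / 2 * ln (x s)))//.
  by rewrite ler_wnM2r// ltW.
by rewrite mulrC -ler_pdivlMr.
Qed.

(** Some empty coordinate has positive drift, since otherwise [positive_of_no_inflow] would put
    [mu 0] in the interior. Its entropy quotient tends to [-oo], and all other terms are bounded
    above. *)
Lemma slope_F_boundary mu C : solution m mu -> ~ simplices_int (mu 0) ->
  slope (fun s => F m C (mu s)) 0 s @[s --> within `[0, +oo[ (0 : R)^'] --> -oo.
Proof.
move=> mus nint; pose x j i z s := pop (mu s) j i ord0 z.
pose h j i z := slope (fun s => x j i z s * ln (x j i z s)) 0.
have mu0S := mus.1 0 (lexx _).
have h_ub j i z : eventually_ub (within `[0, +oo[ (0 : R)^') (h j i z).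
  have := (mu0S j i).1 z; rewrite le_eqVlt => /predU1P[x0|x0].
    exact: slope_xlnx_zero_ub.
  apply: cvg_eventually_ub; apply: slope_xlnx => //.
  - exact: within_ge0_cvg.
  - exact: within_ge0_neq.
  - exact: solution_slope.
have [j [i [z hNy]]] : exists j i z,
    h j i z s @[s --> within `[0, +oo[ (0 : R)^'] --> -oo.
  apply: contrapT => nh; apply: nint => j i; split=> //.
  apply: positive_of_no_inflow => // z x0; rewrite leNgt; apply/negP => d0.
  by apply: nh; exists j, i, z; exact: slope_xlnx_zero_Ny.
pose g j i s := weight m j i * \sum_z h j i z s.
have g_ub j' i' : eventually_ub (within `[0, +oo[ (0 : R)^') (g j' i').
  by apply: eventually_ubM; [exact: weight_gt0|exact: eventually_ub_sum].
have gNy : g j i s @[s --> within `[0, +oo[ (0 : R)^'] --> -oo.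
  by apply: cvgNyM; [exact: weight_gt0|exact: cvgNy_sum hNy _].
have FE0 : slope (fun s => F m C (mu s)) 0 =
    fun s => (\sum_j (g j central s + g j peripheral s)) +
      slope (fun s => interaction m (mu s)) 0 s.
  apply/funext => s; rewrite /slope !FE.
  have -> : \sum_j (g j central s + g j peripheral s) =
      (s - 0)^-1 * (mixing m (mu s) - mixing m (mu 0)).
    rewrite /mixing -sumrB mulr_sumr; apply: eq_bigr => k _.
    by rewrite /g /h /slope /entropy -!mulr_sumr !sumrB /x; ring.
  by ring.
rewrite FE0; apply: cvgNyD; last first.
  apply: cvg_eventually_ub; apply: slope_interaction => //.
  - exact: within_ge0_cvg.
  - exact: within_ge0_neq.
  - by move=> j' i' z'; exact: solution_slope.
apply: (cvgNy_sum (k := j)) => [|k]; last exact: eventually_ubD.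
case: i hNy gNy => hNy gNy; first exact: cvgNyD.
by under eq_fun do rewrite addrC; exact: cvgNyD.
Qed.

End solutions.

(** * Lyapunov property and stability *)

Section lyapunov.
Context {R : realType} {r K : nat} (m : model R r K).
Hypothesis hm : admissible m.
Implicit Types (q phi : state R r K) (mu : R -> state R r K) (t e d : R).
Implicit Types (G : set (state R r K)) (v : state R r K).
Implicit Types (j : 'I_r) (i : node_kind) (z : 'I_K).

(** The rules for slopes along paths, applied at 0 to the affine path [h *: v + q]. *)
Lemma slope_F_line C q v : (forall j i z, 0 < pop q j i ord0 z) ->
  h^-1 *: ((F m C \o shift q) (h *: v) - F m C q) @[h --> 0^'] -->
    dF m q (pop v).
Proof.
move=> q0.
pose mu h : state R r K := h *: v + q.
have mu0 : mu 0 = q by rewrite /mu scale0r add0r.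
have popD j i z h :
    pop (mu h) j i ord0 z = h * pop v j i ord0 z + pop q j i ord0 z.
  by rewrite !popE /mu; case: i; rewrite /= !mxE.
have : slope (fun h => F m C (mu h)) 0 h @[h --> 0^'] --> dF m (mu 0) (pop v).
  apply: slope_F => //; last by rewrite mu0.
  - exact: nbhs_dnbhs.
  - exact: nbhs_dnbhs_neq.
  move=> j i z; apply: cvg_near_cst; near=> h.
  rewrite /slope !popD mul0r add0r addrK subr0 mulKf//.
  by near: h; exact: nbhs_dnbhs_neq.
rewrite mu0; have -> // : (fun h : R =>
    h^-1 *: ((F m C \o shift q) (h *: v) - F m C q)) =
      slope (fun h => F m C (mu h)) 0.
  by apply/funext => h; rewrite /slope mu0 subr0.
Unshelve. all: by end_near. Qed.

Lemma derive_F C q v : (forall j i z, 0 < pop q j i ord0 z) ->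
  'D_v (F m C) q = dF m q (pop v).
Proof. by move=> q0; apply: cvg_lim => //; exact: slope_F_line. Qed.

Lemma C1_on_F C G : C1_on G (F m C).
Proof.
move=> v _; split=> [q [_ q_int]|].
  apply/cvg_ex; exists (dF m q (pop v)); apply: slope_F_line => j i z.
  by case: (q_int j i).
set A := G `&` _.
apply: (@subspace_eq_continuous _ A _ (fun q => dF m q (pop v))).
  move=> q; rewrite inE => -[_ q_int].
  rewrite /from_subspace derive_F// => j i z.
  by case: (q_int j i).
apply: continuous_in_subspaceT => q; rewrite inE => -[_ q_int].
apply: continuous_dF => j i z; last exact: cvg_cst.
by case: (q_int j i).
Qed.

(** The closure of [G] lies in the compact box of coordinates in [0, 1]. *)
Lemma unif_continuous_on_F C G : G `<=` @simplices R r K ->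
  unif_continuous_on G (F m C).
Proof.
move=> GS e e0.
have Gbox : closure G `<=` box 0 1.
  move=> q /(closure_subset GS) qS; apply: simplices_box.
  exact: closed_simplices.
have [d d0 dP] := compact_unif_continuous (@compact_box R r K 0 1)
  (@continuous_F _ _ _ m C) e0.
by exists d => // q q' /Gbox qb /Gbox q'b; exact: dP.
Qed.

Lemma exit_time_gt G mu t : 0 <= t -> (t%:E < exit_time G mu)%E -> G (mu t).
Proof.
move=> t0; apply: contraPP => nG; apply/negP; rewrite -leNgt.
by apply: ereal_inf_lbound; exists t.
Qed.

(** In the interior the derivative is [speed], finite and negative. A boundary point can occur only
    at time 0, and there the slope is [-oo]. *)
Lemma decreasing_at_F C mu t : solution m mu -> 0 <= t ->
  ~ fixed_point m (mu t) -> decreasing_at (F m C) mu t.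
Proof.
move=> mus t0 nfix; have [mut|mut] := pselect (simplices_int (mu t)).
  exists (speed m (mu t))%:E; split => //; last by rewrite lte_fin dF_drift_lt0.
  apply: (@cvg_comp _ _ _ (slope (fun s => F m C (mu s)) t) (@EFin R) _
    (nbhs (speed m (mu t)))); last by move=> A.
  apply: slope_F => //.
  - exact: within_ge0_cvg.
  - exact: within_ge0_neq.
  - by move=> j i z; exact: solution_slope.
  - by move=> j i z; case: (mut j i).
have tE : t = 0.
  apply/eqP; apply: contrapT => /negP tn0; apply: mut.
  by apply: (solution_positive hm) => //; rewrite lt_neqAle eq_sym tn0.
exists -oo%E; split => //.
by apply/cvgerNyP; rewrite tE; apply: slope_F_boundary => //; rewrite -tE.
Qed.

(** * Local stability *)

Section stability.
Context (C : R) (phi : state R r K) (G : set (state R r K)).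
Hypothesis phi_int : simplices_int phi.
Hypothesis G_open : relatively_open G.
Hypothesis G_phi : G phi.
Hypothesis G_fixed : forall q, G q -> fixed_point m q -> q = phi.
Context (Lstar : R).
Hypothesis F_sublevel : forall e, 0 < e -> \forall L \near Lstar^'+,
  hausdorff_close e (sublevel G (F m C) L) [set phi].

Let F_cont := @continuous_F _ _ _ m C.

(** Sublevel sets for [L] just above [Lstar] contain points arbitrarily close to [phi], and F is
    continuous at [phi]. *)
Lemma F_phi_le : F m C phi <= Lstar.
Proof.
apply/ler_addgt0Pr => e e0.
have e2 : 0 < e / 2 by rewrite divr_gt0.
have /cvgrPdist_lt/(_ _ e2)/nbhs_ballP[d /= d0 dP] := @F_cont phi.
have Le : \forall L \near Lstar^'+, L < Lstar + e / 2.
  by apply: nbhs_right_lt; rewrite ltrDl.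
have [L [_ Lphi] {}Le] : exists2 L,
    hausdorff_close d (sublevel G (F m C) L) [set phi] & L < Lstar + e / 2.
  near Lstar^'+ => L; exists L; first by near: L; exact: F_sublevel.
  by near: L; exact: Le.
have [//|q [_ FqL] qphi] := Lphi phi.
have : `|F m C phi - F m C q| < e / 2.
  by apply: dP; rewrite -ball_normE /= distrC.
rewrite ltr_norml => /andP[_]; lra.
Unshelve. all: by end_near. Qed.

Lemma sublevel_small e : 0 < e -> exists2 L, Lstar < L &
  forall q, G q -> F m C q <= L -> `|q - phi| < e.
Proof.
move=> e0; have [L [LL [LP _]]] :=
  filter_ex (filterI (nbhs_right_gt Lstar) (F_sublevel e0)).
exists L => // q Gq FqL; have [|_ -> //] := LP q.
by split=> //; exact: subset_closure.
Qed.

(** Near [phi] the coordinates stay uniformly away from 0, where the logarithms in [speed] would be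
    singular. *)
Lemma ball_phi_positive : exists2 d, 0 < d & exists2 e, 0 < e &
  forall q, `|q - phi| < e -> forall j i z, d <= pop q j i ord0 z.
Proof.
have phi0 j i z : 0 < pop phi j i ord0 z by case: (phi_int j i).
have dpop : \forall d \near (0 : R)^'+,
    forall j i z, d < pop phi j i ord0 z / 2.
  by apply: near_forall_pop => j i z; apply: nbhs_right_lt; rewrite divr_gt0.
have [d [d0 dP]] := filter_ex (filterI (nbhs_right_gt 0) dpop).
exists d => //.
have : \forall q \near phi, forall j i z,
    pop phi j i ord0 z / 2 < pop q j i ord0 z.
  apply: (near_forall_pop (FF := nbhs phi)) => j i z.
  apply: cvgr_gt (@cvg_pop _ _ _ phi j i z) _ _.
  by rewrite ltr_pdivrMr// mulr2n mulrDr mulr1 ltrDl.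
move=> /nbhs_ballP[e /= e0 eP]; exists e => // q qphi j i z.
apply/ltW; apply: lt_trans (dP j i z) _; apply: eP.
by rewrite -ball_normE /= distrC.
Qed.

(* A solution that starts in a low sublevel set stays close to [phi]: the
   distance to [phi] cannot cross [e / 2], since [F] does not increase and
   [F <= L] forces that distance below [e / 2]. *)
Lemma solution_trapped e L mu : 0 < e ->
  (forall q, simplices q -> `|q - phi| < e -> G q) ->
  (forall q, G q -> F m C q <= L -> `|q - phi| < e / 2) ->
  solution m mu -> G (mu 0) -> F m C (mu 0) <= L ->
  forall t, 0 <= t -> G (mu t) /\ `|mu t - phi| < e / 2.
Proof.
move=> e0 eG eL mus G0 F0 t t0.
have FL s : 0 <= s -> F m C (mu s) <= L.
  by move=> s0; apply: le_trans F0; exact: solution_F_nonincreasing.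
suff tphi : `|mu t - phi| < e / 2.
  split => //; apply: eG; first exact: mus.1.
  by apply: lt_trans tphi _; rewrite ltr_pdivrMr// mulr2n mulrDr mulr1 ltrDl.
rewrite ltNge; apply/negP => tphi.
have cn : continuous (fun q => `|q - phi|).
  by move=> q; apply: cvg_norm; apply: cvgB; [exact: cvg_id|exact: cvg_cst].
have [|s] := @IVT R (fun s => `|mu s - phi|) 0 t (e / 2) t0
  (solution_continuous mus cn (lexx 0)).
  by rewrite ge_min le_max tphi orbT andbT ltW// eL.
rewrite in_itv/= => /andP[s0 _] sphi.
have : `|mu s - phi| < e / 2.
  apply: eL (FL _ s0); apply: eG; first exact: mus.1.
  by rewrite sphi ltr_pdivrMr// mulr2n mulrDr mulr1 ltrDl.
by rewrite sphi ltxx.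
Qed.

(** [speed] attains its maximum on the compact set [A]. A maximiser is not a fixed point: the only
    one in [G] is [phi], and F at [phi] is at most [Lstar < L]. *)
Lemma speed_bound d e L : 0 < d -> Lstar < L ->
  (forall q, simplices q -> `|q - phi| <= e -> G q) ->
  (forall q, `|q - phi| <= e -> forall j i z, d <= pop q j i ord0 z) ->
  exists2 c, c < 0 & forall q, simplices q -> `|q - phi| <= e ->
    L <= F m C q -> speed m q <= c.
Proof.
move=> d0 LL eG ed.
pose A := [set q | [/\ simplices q, `|q - phi| <= e & L <= F m C q]].
have A_pos q : A q -> forall j i z, 0 < pop q j i ord0 z.
  by move=> [_ qe _] j i z; exact: lt_le_trans d0 (ed _ qe j i z).
have cA : compact A.
  apply: (subclosed_compact _ (@compact_box R r K 0 1)); last first.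
    by move=> q [qS _ _]; exact: simplices_box.
  have cn : continuous (fun q => `|q - phi|).
    by move=> q; apply: cvg_norm; apply: cvgB; [exact: cvg_id|exact: cvg_cst].
  have -> : A = @simplices R r K
      `&` ((fun q => `|q - phi|) @^-1` [set x | x <= e])
      `&` (F m C @^-1` [set x | L <= x]).
    by apply/seteqP; split => [q [? ? ?]|q [[? ?] ?]]; split.
  apply: closedI; first apply: closedI; first exact: closed_simplices.
    by apply: closed_comp => [q _|]; [exact: cn|exact: closed_le].
  by apply: closed_comp => [q _|]; [exact: F_cont|exact: closed_ge].
have [[q0 Aq0]|A0] := pselect (A !=set0); last first.
  (* If [A] is empty, any negative constant will do. *)
  exists (-1); first by rewrite ltrN10.
  by move=> q qS qe Lq; exfalso; apply: A0; exists q.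
have cs : {within A, continuous (speed m)}.
  apply: continuous_in_subspaceT => q; rewrite inE => /A_pos qp.
  by apply: continuous_dF => // j i z; exact: continuous_drift.
have [q1 Aq1 q1P] := compact_EVT_max (ex_intro _ _ Aq0) cA cs.
exists (speed m q1); last by move=> q qS qe Lq; apply: q1P; rewrite inE.
move: Aq1; rewrite inE => Aq1; have [q1S q1e Lq1] := Aq1.
apply: dF_drift_lt0 => //.
  by move=> j i; split => // z; exact: A_pos.
move=> /(G_fixed (eG _ q1S q1e)) q1phi.
by move: Lq1; rewrite q1phi leNgt (le_lt_trans F_phi_le).
Qed.

Lemma F_stable : locally_stable m phi.
Proof.
have [U U_open GU] := G_open.
have [d d0 [e1 e10 dP]] := ball_phi_positive.
have /nbhs_ballP[e2 /= e20 e2P] : nbhs phi U.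
  by apply: open_nbhs_nbhs; split => //; move: G_phi; rewrite GU => -[].
(* Within [e] of [phi], states of the simplices lie in [G] and coordinates are at least [d]. *)
pose e := Num.min e1 e2.
have e0 : 0 < e by rewrite lt_min e10.
have eG q : simplices q -> `|q - phi| < e -> G q.
  move=> qS; rewrite lt_min => /andP[_ qe]; rewrite GU; split => //.
  by apply: e2P; rewrite -ball_normE /= distrC.
have eP q : `|q - phi| < e -> forall j i z, d <= pop q j i ord0 z.
  by rewrite lt_min => /andP[qe _]; exact: dP.
have e2e x : x <= e / 2 -> x < e.
  move=> /le_lt_trans; apply.
  by rewrite ltr_pdivrMr// mulr2n mulrDr mulr1 ltrDl.
have [|L0 LL0 L0P] := @sublevel_small (e / 2); first by rewrite divr_gt0.
(* The neighbourhood of attraction contains [phi] because F there is at most [Lstar < L0]. *)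
exists (G `&` [set q | F m C q < L0]); split.
- exists (U `&` (F m C @^-1` [set x | x < L0])); last first.
    by rewrite GU setIAC.
  apply: openI => //.
  by apply: open_comp => [q _|]; [exact: F_cont|exact: open_lt].
- by split => //=; exact: le_lt_trans F_phi_le LL0.
move=> mu mus [G0 /ltW F0].
have trap := solution_trapped e0 eG L0P mus G0 F0.
apply/cvgrPdist_lt => x x0; have [L LL LP] := sublevel_small x0.
(* Reaching the level [L] once is enough, as F does not increase afterwards. *)
suff [T T0 FT] : exists2 T, 0 <= T & F m C (mu T) <= L.
  near=> t; have Tt : T <= t by near: t; exact: (nbhs_pinfty_ge (num_real T)).
  have t0 := le_trans T0 Tt; rewrite distrC.
  apply: LP; first by case: (trap t t0).
  by apply: le_trans FT; exact: solution_F_nonincreasing.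
apply: contrapT => nT.
have FL t : 0 <= t -> L < F m C (mu t).
  by move=> t0; rewrite ltNge; apply/negP => Ft; apply: nT; exists t.
have [c c0 cP] := @speed_bound d (e / 2) L d0 LL
  (fun q qS qe => eG q qS (e2e _ qe)) (fun q qe => eP q (e2e _ qe)).
(* Time by which a decrease at rate at least [- c] brings F from its initial value down to [L]. *)
pose T := (F m C (mu 0) - L) / - c.
have T0 : 0 <= T by rewrite divr_ge0 ?oppr_ge0 ?(ltW c0)// subr_ge0 ltW// FL.
have := @solution_F_decrease _ _ _ _ hm mu C 0 T c mus (lexx _) T0.
have -> : c * (T - 0) = L - F m C (mu 0).
  by rewrite /T; field; rewrite lt_eqF.
have H t : 0 < t -> t < T -> speed m (mu t) <= c.
  move=> /ltW t0 _; have [_ /ltW te] := trap t t0.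
  by apply: cP => //; [exact: mus.1|exact/ltW/FL].
move=> /(_ H); rewrite lerBlDr subrK leNgt => /negP; apply.
exact: FL.
Unshelve. all: by end_near. Qed.

End stability.
End lyapunov.

Theorem mainTheorem6 (R : realType) (r K : nat) (m : model R r K)
    (hm : admissible m) (C : R)
    (phi : state R r K) (phi_int : simplices_int phi)
    (phi_fixed : fixed_point m phi)
    (G : set (state R r K)) (G_open : relatively_open G) (G_phi : G phi)
    (G_fixed : forall q, G q -> fixed_point m q -> q = phi)
    (F_posdef : positive_definite G phi (F m C)) :
  local_lyapunov m G phi (F m C) /\ locally_stable m phi.
Proof.
split; last by have [Lstar [FL _]] := F_posdef; exact: (F_stable hm _ _ _ _ FL).
split => //; first exact: C1_on_F.
  by apply: unif_continuous_on_F; have [U _ ->] := G_open => q [].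
(* Before the exit time the solution is in [G], so by [G_fixed] a state other than [phi] is not a
   fixed point and F decreases strictly. *)
move=> mu mus G0 t t0 tG nphi; apply: decreasing_at_F => // fixt.
by apply: nphi; apply: G_fixed => //; exact: exit_time_gt tG.
Qed.
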